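(* Assume that $\varepsilon$ is a standard Gaussian vector in $\mathbb{R}^n$, and let $\{L_m, m\in\mathcal{M}\}$ be a collection of nonnegative numbers. Let $\theta>0$. If the penalty function $\mathrm{pen}:\mathcal{M}\to\mathbb{R}_+$ satisfies $$\mathrm{pen}(m)\ge(1+\theta+L_m)\frac{\mathrm{Tr}({}^tP_n\pi_mP_n)}{n}\sigma^2\quad\text{for all }m\in\mathcal{M},$$ then the penalized least-squares estimator $\tilde s=\hat s_{\hat m}$ satisfies $$\mathbb{E}\left[\|s-\tilde s\|_n^2\right]\le C\inf_{m\in\mathcal{M}}\left\{\|s-s_m\|_n^2+\mathrm{pen}(m)-\frac{\mathrm{Tr}({}^tP_n\pi_mP_n)}{n}\sigma^2\right\}+\frac{\rho^2(P_n)\sigma^2}{n}R_n(\theta),$$ where $$R_n(\theta)=C'\sum_{m\in\mathcal{M}}\exp\left(-\frac{C''L_m\mathrm{Tr}({}^tP_n\pi_mP_n)}{\rho^2(P_n)}\right)$$ and $C>1$ and $C',C''>0$ are constants that depend only on $\theta$.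
   Context: For $x,y\in\mathbb{R}^n$: $\|x\|_n^2=\frac1n\sum_{i=1}^nx_i^2$ and $\langle x,y\rangle_n=\frac1n\sum_{i=1}^nx_iy_i$. For a real $n\times n$ matrix $A$, $\rho(A)=\sup_{x\ne0}\|Ax\|_n/\|x\|_n$ is the spectral norm, and ${}^tA$ is the transpose. One observes $Y=s+\sigma P_n\varepsilon\in\mathbb{R}^n$, where $P_n\neq 0$ is a known real $n\times n$ matrix (not necessarily invertible), $s\in\mathrm{Im}(P_n)$ is unknown and deterministic, $\sigma>0$ is known, and $\varepsilon=(\varepsilon_1,\dots,\varepsilon_n)'$ is a random vector with i.i.d. centered components of unit variance. $\{S_m,\ m\in\mathcal{M}\}$ is a finite or countable collection of linear subspaces of $\mathrm{Im}(P_n)$; $\pi_m$ is the orthogonal projection onto $S_m$; $s_m=\pi_ms$; $\hat s_m=\pi_mY$. Given a penalty function $\mathrm{pen}$, $\hat m$ is any minimizer over $m\in\mathcal{M}$ of $\|Y-\hat s_m\|_n^2+\mathrm{pen}(m)$, and $\tilde s=\hat s_{\hat m}$. *)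

(* Defs.v *)
From HB Require Import structures.
From mathcomp Require Import all_boot all_order all_algebra.
From mathcomp Require Import all_classical all_reals all_analysis.

Set Implicit Arguments.
Unset Strict Implicit.
Unset Printing Implicit Defensive.

Import Order.TTheory GRing.Theory Num.Theory.
Import numFieldNormedType.Exports.

Local Open Scope classical_set_scope.
Local Open Scope ring_scope.

Definition ninner (R : realType) (n : nat) (x y : 'cV[R]_n) : R :=
  n%:R^-1 * \sum_(i < n) x i 0 * y i 0.

Definition nnorm (R : realType) (n : nat) (x : 'cV[R]_n) : R :=
  Num.sqrt (n%:R^-1 * \sum_(i < n) x i 0 ^+ 2).

Definition spectral_norm (R : realType) (n : nat) (A : 'M[R]_n) : R :=
  sup [set nnorm (A *m x) / nnorm x | x in [set x : 'cV[R]_n | x != 0]].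

Definition im_mx (R : realType) (n : nat) (A : 'M[R]_n) : {vspace 'cV[R]_n} :=
  limg (linfun (mulmx A : 'cV[R]_n -> 'cV[R]_n)).

Lemma im_mxP (R : realType) (n : nat) (A : 'M[R]_n) (y : 'cV[R]_n) :
  y \in im_mx A <-> exists x : 'cV[R]_n, y = A *m x.
Proof.
split=> [/memv_imgP[x _ ->]|[x ->]]; first by exists x; rewrite lfunE.
by apply/memv_imgP; exists x; rewrite ?memvf ?lfunE.
Qed.

(** The orthogonal complement of [U], as the kernel of the matrix whose rows
    are the vectors of a basis of [U]; see [orthvP]. *)
Definition orthv (R : realType) (n : nat) (U : {vspace 'cV[R]_n}) :
    {vspace 'cV[R]_n} :=
  lker (linfun (mulmx (\matrix_(i < \dim U) ((vbasis U)`_i)^T)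
                : 'cV[R]_n -> 'cV[R]_(\dim U))).

(** The matrix, in the canonical basis, of the projection onto [U] along
    [orthv U]; see [orthprojP]. *)
Definition orthproj (R : realType) (n : nat) (U : {vspace 'cV[R]_n}) : 'M[R]_n :=
  \matrix_(i < n, j < n) (daddv_pi U (orthv U) (delta_mx j 0)) i 0.

Lemma orthvP (R : realType) (n : nat) (U : {vspace 'cV[R]_n}) (x : 'cV[R]_n) :
  x \in orthv U <-> forall u : 'cV[R]_n, u \in U -> ninner x u = 0.
Proof.
set B := \matrix_(i < \dim U) ((vbasis U)`_i)^T.
have BE i : (B *m x) i 0 = \sum_(k < n) x k 0 * (vbasis U)`_i k 0.
  by rewrite mxE; apply: eq_bigr => k _; rewrite !mxE mulrC.
have -> : x \in orthv U = (B *m x == 0) by rewrite memv_ker lfunE.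
split=> [/eqP Bx0 u uU|xU].
  rewrite /ninner (coord_vbasis uU).
  under eq_bigr => k _ do rewrite summxE mulr_sumr.
  rewrite exchange_big /= big1 ?mulr0// => i _.
  under eq_bigr => k _ do rewrite mxE mulrCA.
  by rewrite -mulr_sumr -BE Bx0 mxE mulr0.
apply/eqP/colP => i; rewrite BE mxE.
have [n0|n_gt0] := posnP n.
  by rewrite big1// => k; have := ltn_ord k; rewrite {2}n0.
have /xU /eqP : (vbasis U)`_i \in U by rewrite vbasis_mem// mem_nth// size_tuple.
by rewrite mulf_eq0 invr_eq0 pnatr_eq0 eqn0Ngt n_gt0 /= => /eqP.
Qed.

Lemma orthvI (R : realType) (n : nat) (U : {vspace 'cV[R]_n}) :
  (U :&: orthv U = 0)%VS.
Proof.
apply/eqP; rewrite -subv0; apply/subvP => x; rewrite memv_cap => /andP[xU].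
move=> /orthvP/(_ _ xU)/eqP; rewrite memv0 mulf_eq0 invr_eq0 pnatr_eq0.
case/orP => [/eqP n0|]; first by apply/eqP/colP => k; have := ltn_ord k; rewrite {2}n0.
rewrite psumr_eq0 => [/allP x0|k _]; last by rewrite -expr2 sqr_ge0.
apply/eqP/colP => k; rewrite mxE; have := x0 k (mem_index_enum _).
by rewrite /= mulf_eq0 orbb => /eqP.
Qed.

Lemma orthvD (R : realType) (n : nat) (U : {vspace 'cV[R]_n}) :
  (U + orthv U = fullv)%VS.
Proof.
apply/eqP; rewrite eqEdim subvf /= dimv_disjoint_sum ?orthvI//.
rewrite -(limg_ker_dim (linfun (mulmx (\matrix_(i < \dim U) ((vbasis U)`_i)^T)
                : 'cV[R]_n -> 'cV[R]_(\dim U))) fullv) capfv addnC leq_add2r.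
by rewrite (leq_trans (dimvS (subvf _)))// dimvf /dim /= muln1.
Qed.

Lemma orthprojP (R : realType) (n : nat) (U : {vspace 'cV[R]_n}) (x : 'cV[R]_n) :
  orthproj U *m x \in U /\
  forall u : 'cV[R]_n, u \in U -> ninner (x - orthproj U *m x) u = 0.
Proof.
have -> : orthproj U *m x = daddv_pi U (orthv U) x.
  rewrite [in RHS](matrix_sum_delta x) linear_sum/=.
  apply/colP => i; rewrite mxE summxE; apply: eq_bigr => j _.
  by rewrite big_ord1 linearZ !mxE mulrC.
split; first exact: memv_pi.
apply/orthvP.
have xf : x \in (U + orthv U)%VS by rewrite orthvD memvf.
by rewrite -{1}(daddv_pi_add (orthvI U) xf) addrC addKr memv_pi.
Qed.

Definition mutually_independent (R : realType) (d : measure_display)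
    (T : measurableType d) (P : probability T R) (n : nat)
    (X : 'I_n -> {RV P >-> R}) : Prop :=
  forall (J : {set 'I_n}) (B : 'I_n -> set R),
    (forall i, measurable (B i)) ->
    P (\bigcap_(i in [set` J]) (X i @^-1` B i)) =
    (\prod_(i in J) P (X i @^-1` B i))%E.

Definition standard_gaussian_vector (R : realType) (d : measure_display)
    (T : measurableType d) (P : probability T R) (n : nat)
    (eps : 'I_n -> {RV P >-> R}) : Prop :=
  mutually_independent eps /\
  forall (i : 'I_n) (B : set R), measurable B ->
    distribution P (eps i) B = normal_prob 0 1 B.

Definition observation (R : realType) (n : nat) (T : Type) (Pn : 'M[R]_n)
    (s : 'cV[R]_n) (sigma : R) (eps : 'I_n -> T -> R) (w : T) : 'cV[R]_n :=
  s + sigma *: (Pn *m \col_(i < n) eps i w).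

Definition is_penalized_minimizer (R : realType) (n : nat) (M : Type)
    (S : M -> {vspace 'cV[R]_n}) (pen : M -> R) (y : 'cV[R]_n) (m0 : M) : Prop :=
  forall m : M,
    nnorm (y - orthproj (S m0) *m y) ^+ 2 + pen m0 <=
    nnorm (y - orthproj (S m) *m y) ^+ 2 + pen m.

Definition trace_term (R : realType) (n : nat) (Pn : 'M[R]_n)
    (U : {vspace 'cV[R]_n}) : R :=
  \tr (Pn^T *m orthproj U *m Pn).

(* Main.v *)
Require Import Defs.
From HB Require Import structures.
From mathcomp Require Import all_boot all_order all_algebra.
From mathcomp Require Import all_classical all_reals all_analysis.
From mathcomp Require Import measurable_realfun.
From mathcomp Require Import ring lra.

Set Implicit Arguments.
Unset Strict Implicit.
Unset Printing Implicit Defensive.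

Import Order.TTheory GRing.Theory Num.Theory.
Import numFieldNormedType.Exports.

Local Open Scope classical_set_scope.
Local Open Scope ring_scope.

(** The Gaussian noise enters only through the exponential moments of quadratic
    forms. If [|A x|^2 <= r |x|^2] and [2 l r < 1], integrating out the
    coordinates one at a time gives
    [E exp(l |A eps|^2) <= exp(l Tr(A A^T) / (1 - 2 l r))]: integrating a
    coordinate with column [a] replaces the inverse [K] of the current form by
    [K - a a^T], and a lower bound on [K - A A^T] is preserved throughout.

    Comparing the criterion at the selected model with that at a fixed model [m]
    and splitting the cross terms by AM-GM bounds a multiple of the loss by the
    oracle term at [m] plus the excess, at both models, of the forms
    [|pi_m P eps|^2] and [<u_m, P eps>^2] over the penalty, where [u_m] is the
    normalized bias [s - s_m]. By [x <= exp x] each excess is at most an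
    exponential whose expectation is, up to a constant, a term of the remainder
    series, and the subtracted trace term is recovered from the slack [theta] in
    the penalty. *)

(** * One-dimensional Gaussian integrals *)

(** The Radon-Nikodym derivative of the normal law agrees almost everywhere with [normal_pdf],
    because both integrate to the same value over every measurable set. *)
Lemma ge0_integral_normal_prob (R : realType) (m s : R)
    (f : measurableTypeR R -> \bar R) :
  measurable_fun setT f -> (forall x, (0 <= f x)%E) ->
  (\int[normal_prob m s]_x f x =
   \int[lebesgue_measure]_x (f x * (normal_pdf m s x)%:E))%E.
Proof.
move=> mf f0.
have dom := normal_prob_dominates m s.
have mpdf : measurable_fun [set: measurableTypeR R]
    (fun x => (normal_pdf m s x)%:E).
  by apply/measurable_EFinP; exact: measurable_normal_pdf.
rewrite -(Radon_Nikodym_SigmaFinite.change_of_variables dom)//.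
have RNi := Radon_Nikodym_SigmaFinite.f_integrable dom.
apply: ae_eq_integral => //.
- by apply: emeasurable_funM => //; exact: measurable_int RNi.
- exact: emeasurable_funM.
- apply: ae_eqe_mul2l; apply: integral_ae_eq => // E _ mE.
  by rewrite -(Radon_Nikodym_SigmaFinite.f_integral dom).
Qed.

Lemma measurable_expR_quadratic (R : realType) (u v : R) :
  measurable_fun [set: measurableTypeR R]
    (fun t => (expR (v * t + u * t ^+ 2 / 2))%:E).
Proof.
apply/measurable_EFinP/measurableT_comp; first exact: measurable_expR.
apply: measurable_funD; first exact: measurable_funM.
by do 2 apply: measurable_funM => //; exact: measurable_funX.
Qed.

(** Completing the square: the integrand times the density is a constant times the normal density of
    mean [v / (1 - u)] and variance [(1 - u)^-1]. *)
Lemma gaussian_integral_exp_quadratic (R : realType) (u v : R) : u < 1 ->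
  (\int[normal_prob 0 1]_t (expR (v * t + u * t ^+ 2 / 2))%:E =
   ((Num.sqrt (1 - u))^-1 * expR (v ^+ 2 / (1 - u) / 2))%:E)%E.
Proof.
move=> u1; have u0 : 0 < 1 - u by rewrite subr_gt0.
pose s := (Num.sqrt (1 - u))^-1.
have s_gt0 : 0 < s by rewrite invr_gt0 sqrtr_gt0.
have s2 : s ^+ 2 = (1 - u)^-1 by rewrite exprVn sqr_sqrtr// ltW.
pose k := s * expR (v ^+ 2 / (1 - u) / 2).
rewrite ge0_integral_normal_prob; last 2 first.
- exact: measurable_expR_quadratic.
- by move=> x; rewrite lee_fin expR_ge0.
under eq_integral => t _.
  have -> : ((expR (v * t + u * t ^+ 2 / 2))%:E * (normal_pdf 0 1 t)%:E =
      k%:E * (normal_pdf (v / (1 - u)) s t)%:E)%E.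
    rewrite -!EFinM; congr EFin.
    rewrite !normal_pdfE ?oner_eq0 ?gt_eqF// /normal_peak /normal_fun.
    rewrite -[_ *+ 2 in RHS]mulrnAr sqrtrM ?sqr_ge0// sqrtr_sqr gtr0_norm//.
    rewrite expr1n mul1r invfM /k mulrCA -expRD.
    rewrite [RHS]mulrACA [s * _]mulrA mulfV ?gt_eqF// mul1r -expRD s2.
    congr (_ * expR _); rewrite subr0 -[_ *+ 2]mulr_natr.
    by field; lra.
  over.
rewrite ge0_integralZl//.
- by rewrite integral_normal_pdf mule1.
- by apply/measurable_EFinP; exact: measurable_normal_pdf.
- by move=> x _; rewrite lee_fin normal_pdf_ge0.
- by rewrite lee_fin mulr_ge0// ?ltW// expR_ge0.
Qed.

(** * Independence and integration over one coordinate *)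

(** Sub-families are recovered by taking [setT] for some of the [B i]; a product over all indices
    suits induction on [n]. *)
Definition iid_normal (R : realType) d (T : measurableType d)
    (P : probability T R) n (eps : 'I_n -> {RV P >-> R}) :=
  forall B : 'I_n -> set R, (forall i, measurable (B i)) ->
    P (\bigcap_i (eps i @^-1` B i)) = (\prod_(i < n) normal_prob 0 1 (B i))%E.

Lemma standard_gaussian_iid_normal (R : realType) d (T : measurableType d)
    (P : probability T R) n (eps : 'I_n -> {RV P >-> R}) :
  standard_gaussian_vector eps -> iid_normal eps.
Proof.
move=> [ind dist] B mB.
have <- : [set` [set: 'I_n]%SET] = [set: 'I_n].
  by apply/seteqP; split=> i //= _; rewrite inE.
rewrite ind//; apply: eq_big => [i|i _]; first by rewrite inE.
by rewrite -(dist i).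
Qed.

(** The joint law of [X] and [Z] agrees on rectangles with the product of [m1] and the law of [Z],
    hence equals it; Tonelli's theorem then integrates over [X] first. *)
Lemma ge0_integral_indep (R : realType) d d1 d2 (T : measurableType d)
    (T1 : measurableType d1) (T2 : measurableType d2)
    (P : probability T R) (m1 : probability T1 R) (X : T -> T1) (Z : T -> T2)
    (f : T1 * T2 -> \bar R) :
  measurable_fun setT X -> measurable_fun setT Z -> measurable_fun setT f ->
  (forall x, (0 <= f x)%E) ->
  (forall A B, measurable A -> measurable B ->
    P (X @^-1` A `&` Z @^-1` B) = (m1 A * P (Z @^-1` B))%E) ->
  (\int[P]_w f (X w, Z w) = \int[P]_w \int[m1]_t f (t, Z w))%E.
Proof.
move=> mX mZ mf f0 ind.
pose Zf : {RV P >-> T2} := HB.pack Z (isMeasurableFun.Build _ _ _ _ Z mZ).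
have mXZ : measurable_fun setT (fun w => (X w, Z w)) by exact: measurable_fun_pair.
pose XZ : {RV P >-> (T1 * T2)%type} := HB.pack (fun w => (X w, Z w))
   (isMeasurableFun.Build _ _ _ _ (fun w => (X w, Z w)) mXZ).
rewrite -(ge0_integral_distribution XZ)//.
rewrite -(@eq_measure_integral _ _ _ _ (distribution P XZ)
  (m1 \x distribution P Zf)%E); last first.
  by move=> A mA _; apply: product_measure_unique.
rewrite fubini_tonelli2// ge0_integral_distribution//.
  exact: measurable_fun_fubini_tonelli_G.
by move=> y; apply: integral_ge0 => x _.
Qed.

(** Generates the sigma-algebra of all coordinates but the first. Intersections replace single
    preimages so that the family is stable under intersection. *)
Definition tail_cylinders (R : realType) (T : Type) n (eps : 'I_n.+1 -> T -> R) :
    set (set T) :=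
  [set \bigcap_i (eps (lift ord0 i) @^-1` B i) |
    B in [set B : 'I_n -> set R | forall i, measurable (B i)]].

Lemma iid_normal_behead (R : realType) d (T : measurableType d)
    (P : probability T R) n (eps : 'I_n.+1 -> {RV P >-> R}) :
  iid_normal eps -> iid_normal (fun i => eps (lift ord0 i)).
Proof.
move=> ie B mB.
have := ie (fun i => if unlift ord0 i is Some j then B j else setT).
rewrite big_ord_recl unlift_none probability_setT mul1e.
under eq_bigr do rewrite liftK.
move=> <-; last by move=> i; case: unlift.
congr (P _); apply/seteqP; split=> w /= Bw i _; last first.
  by have := Bw (lift ord0 i) I; rewrite liftK.
by case: unliftP => [j ->|//]; exact: Bw.
Qed.

(** For fixed [A], both sides are finite measures in [E] that agree on the cylinders, a family
    stable under intersection; hence they agree on the generated sigma-algebra. *)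
Lemma iid_normal_head_indep (R : realType) d (T : measurableType d)
    (P : probability T R) n (eps : 'I_n.+1 -> {RV P >-> R}) (A : set R)
    (E : set T) :
  iid_normal eps -> measurable A -> <<s tail_cylinders eps >> E ->
  P (eps ord0 @^-1` A `&` E) = (normal_prob 0 1 A * P E)%E.
Proof.
move=> ie mA GE.
have mX : measurable (eps ord0 @^-1` A).
  by rewrite -[X in measurable X]setTI; exact: measurable_funP.
have Gm : tail_cylinders eps `<=` measurable.
  move=> _ [B mB <-]; apply: fin_bigcap_measurable => // i _.
  by rewrite -[X in measurable X]setTI; exact: measurable_funP.
have Afin : normal_prob 0 1 A \is a fin_num by exact: fin_num_measure.
have k0 : (0 <= fine (normal_prob 0 1 A))%R by exact: fine_ge0.
pose k := NngNum k0.
have kE : k%:num%:E = normal_prob 0 1 A by exact: (fineK Afin).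
suff : P (E `&` eps ord0 @^-1` A) = (k%:num%:E * P E)%E.
  by rewrite setIC kE.
have := @g_sigma_algebra_measure_unique _ R T (tail_cylinders eps) Gm
  (fun=> setT) _ _ (mrestr P mX) (mscale k P) _ _ _ E GE.
apply.
- move=> _; exists (fun=> setT) => //; apply/seteqP; split => // w _ i _.
- by apply/seteqP; split => // w _; exists 0%N.
- move=> _ _ [B mB <-] [C mC <-]; exists (fun i => B i `&` C i).
    by move=> i; exact: measurableI.
  by rewrite -bigcapI.
- move=> _ [B mB <-].
  transitivity (k%:num%:E * P (\bigcap_i eps (lift ord0 i) @^-1` B i))%E; last by [].
  rewrite kE.
  have := ie (fun i => if unlift ord0 i is Some j then B j else A).
  rewrite big_ord_recl unlift_none.
  under eq_bigr do rewrite liftK.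
  rewrite -(iid_normal_behead ie mB).
  move=> /(_ _)/(etrans _); apply; last by move=> i; case: unlift.
  congr (P _); apply/seteqP; split=> [w /= [Bw Aw] i _|w /= Bw].
    by case: unliftP => [j ->|-> //]; exact: Bw.
  split => [i _|]; first by have := Bw (lift ord0 i) I; rewrite liftK.
  by have := Bw ord0 I; rewrite unlift_none.
- move=> _; apply: le_lt_trans (ltry 1).
  exact: (probability_le1 P (measurableI _ _ measurableT mX)).
Qed.

(** * The Euclidean inner product *)

Definition dot (R : realType) k (x y : 'cV[R]_k) : R := (x^T *m y) 0 0.

Section dot.
Variable R : realType.
Implicit Types (k n : nat).

Lemma dotE k (x y : 'cV[R]_k) : dot x y = \sum_i x i 0 * y i 0.
Proof. by rewrite /dot mxE; apply: eq_bigr => i _; rewrite mxE. Qed.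

Lemma dotC k (x y : 'cV[R]_k) : dot x y = dot y x.
Proof. by rewrite !dotE; apply: eq_bigr => i _; rewrite mulrC. Qed.

Lemma dotDl k (x y z : 'cV[R]_k) : dot (x + y) z = dot x z + dot y z.
Proof. by rewrite /dot linearD mulmxDl mxE. Qed.

Lemma dotDr k (x y z : 'cV[R]_k) : dot z (x + y) = dot z x + dot z y.
Proof. by rewrite /dot mulmxDr mxE. Qed.

Lemma dotZl k a (x y : 'cV[R]_k) : dot (a *: x) y = a * dot x y.
Proof. by rewrite /dot linearZ /= -scalemxAl mxE. Qed.

Lemma dotZr k a (x y : 'cV[R]_k) : dot x (a *: y) = a * dot x y.
Proof. by rewrite /dot -scalemxAr mxE. Qed.

Lemma dotNl k (x y : 'cV[R]_k) : dot (- x) y = - dot x y.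
Proof. by rewrite -scaleN1r dotZl mulN1r. Qed.

Lemma dotNr k (x y : 'cV[R]_k) : dot x (- y) = - dot x y.
Proof. by rewrite dotC dotNl dotC. Qed.

Lemma dotBl k (x y z : 'cV[R]_k) : dot (x - y) z = dot x z - dot y z.
Proof. by rewrite dotDl dotNl. Qed.

Lemma dotBr k (x y z : 'cV[R]_k) : dot z (x - y) = dot z x - dot z y.
Proof. by rewrite dotDr dotNr. Qed.

Lemma dot0l k (y : 'cV[R]_k) : dot 0 y = 0.
Proof. by rewrite -(scale0r 0) dotZl mul0r. Qed.

Lemma dot_mulmx k n (A : 'M[R]_(k, n)) x y : dot (A *m x) y = dot x (A^T *m y).
Proof. by rewrite /dot trmx_mul mulmxA. Qed.

Lemma dot_ge0 k (x : 'cV[R]_k) : 0 <= dot x x.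
Proof. by rewrite dotE sumr_ge0// => i _; rewrite -expr2 sqr_ge0. Qed.

Lemma dot_eq0 k (x : 'cV[R]_k) : (dot x x == 0) = (x == 0).
Proof.
apply/eqP/eqP => [|->]; last by rewrite dot0l.
rewrite dotE => /psumr_eq0P x0; apply/colP => i; rewrite mxE.
by apply/eqP; rewrite -sqrf_eq0 expr2 x0// => j _; rewrite -expr2 sqr_ge0.
Qed.

Lemma dot_gt0 k (x : 'cV[R]_k) : x != 0 -> 0 < dot x x.
Proof. by move=> x0; rewrite lt0r dot_eq0 x0 dot_ge0. Qed.

Lemma dot_CauchySchwarz k (x y : 'cV[R]_k) :
  dot x y ^+ 2 <= dot x x * dot y y.
Proof.
have [->|/dot_gt0 y0] := eqVneq y 0; first by rewrite dotC !dot0l expr0n mulr0.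
have := dot_ge0 (dot y y *: x - dot x y *: y).
rewrite !(dotBl, dotBr, dotZl, dotZr) (dotC y x) => h.
rewrite -subr_ge0 -(pmulr_rge0 _ y0).
by apply: le_trans h _; rewrite le_eqVlt; apply/orP; left; apply/eqP; ring.
Qed.

Lemma mulmx_outer k (a y : 'cV[R]_k) : a *m a^T *m y = dot a y *: a.
Proof.
by rewrite -mulmxA [a^T *m y]mx11_scalar mul_mx_scalar.
Qed.

Lemma trace_mulmx_tr k n (A : 'M[R]_(k, n)) :
  \tr (A *m A^T) = \sum_j dot (col j A) (col j A).
Proof.
rewrite /mxtrace; under eq_bigr do rewrite mxE.
rewrite exchange_big /=; apply: eq_bigr => j _; rewrite dotE.
by apply: eq_bigr => i _; rewrite !mxE.
Qed.

Lemma trace_mulmx_tr_ge0 k n (A : 'M[R]_(k, n)) : 0 <= \tr (A *m A^T).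
Proof. by rewrite trace_mulmx_tr sumr_ge0// => j _; exact: dot_ge0. Qed.

Lemma mulmx_col_recl k n (A : 'M[R]_(k, n.+1)) (x : 'I_n.+1 -> R) :
  A *m (\col_i x i) =
  x ord0 *: col ord0 A + col' ord0 A *m \col_i x (lift ord0 i).
Proof.
apply/colP => i; rewrite !mxE big_ord_recl !mxE mulrC; congr (_ + _).
by apply: eq_bigr => j _; rewrite !mxE.
Qed.

Lemma dot_tr_col_recl k n (A : 'M[R]_(k, n.+1)) (y : 'cV[R]_k) :
  dot (A^T *m y) (A^T *m y) =
  dot (col ord0 A) y ^+ 2 + dot ((col' ord0 A)^T *m y) ((col' ord0 A)^T *m y).
Proof.
rewrite !dotE big_ord_recl expr2; congr (_ + _).
  by congr (_ * _); rewrite mxE; apply: eq_bigr => i _; rewrite !mxE.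
by apply: eq_bigr => j _; congr (_ * _); rewrite !mxE; apply: eq_bigr => i _;
  rewrite !mxE.
Qed.

Lemma trace_col_recl k n (A : 'M[R]_(k, n.+1)) :
  \tr (A *m A^T) = dot (col ord0 A) (col ord0 A) +
    \tr (col' ord0 A *m (col' ord0 A)^T).
Proof.
rewrite !trace_mulmx_tr big_ord_recl; congr (_ + _).
by apply: eq_bigr => j _; congr dot; apply/colP => i; rewrite !mxE.
Qed.

(** * Rank-one update of a quadratic form and of its inverse *)

Section pivot.
Variables (k : nat) (H K : 'M[R]_k) (a : 'cV[R]_k) (c : R).
Hypotheses (c_gt0 : 0 < c) (KH : K *m H = 1%:M) (Hsym : H^T = H).
Hypothesis Kpos : forall y, c * dot y y <= dot y (K *m y) - dot a y ^+ 2.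
Let u := dot a (H *m a).
Let H' := H + (1 - u)^-1 *: (H *m a *m a^T *m H).

(** Testing [Kpos] at [H *m a] bounds c |H a|^2 by u (1 - u). If u >= 1, this forces H a = 0, hence
    u = 0. *)
Lemma pivot_lt1 : u < 1.
Proof.
have := Kpos (H *m a); rewrite mulmxA KH mul1mx (dotC _ a) -/u => h.
rewrite ltNge; apply/negP => u1.
have : c * dot (H *m a) (H *m a) <= 0 by apply: le_trans h _; nra.
rewrite pmulr_rle0// => h0.
have /eqP : dot (H *m a) (H *m a) == 0 by rewrite eq_le h0 dot_ge0.
move/eqP; rewrite dot_eq0 => /eqP Ha0.
by move: u1; rewrite /u Ha0 dotC dot0l ler10.
Qed.

Let u1 : 1 - u != 0.
Proof. by rewrite subr_eq0 gt_eqF// pivot_lt1. Qed.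

(** The Sherman-Morrison formula. *)
Lemma pivot_inverse : (K - a *m a^T) *m H' = 1%:M.
Proof.
pose X := a *m a^T *m H.
have aHa : a *m a^T *m H *m a *m a^T *m H = u *: X.
  transitivity (a *m (a^T *m (H *m a)) *m (a^T *m H)); first by rewrite !mulmxA.
  rewrite [a^T *m (H *m a)]mx11_scalar -/(dot a (H *m a)) -/u.
  by rewrite mul_mx_scalar -scalemxAl mulmxA.
rewrite /H' mulmxDr !mulmxBl KH -!scalemxAr !mulmxA KH mul1mx aHa -/X.
rewrite -scalerBr -{2}(scale1r X) -scalerBl scalerA mulVf// scale1r.
by rewrite subrK.
Qed.

Lemma pivot_sym : H'^T = H'.
Proof.
by rewrite /H' linearD linearZ /= !trmx_mul trmxK Hsym !mulmxA.
Qed.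

(** The added square is the one that the Gaussian integral over the first coordinate produces from
    the linear coefficient [dot (H *m a) y]. *)
Lemma pivot_form y :
  dot y (H' *m y) = dot y (H *m y) + dot (H *m a) y ^+ 2 / (1 - u).
Proof.
rewrite /H' mulmxDl dotDr -scalemxAl dotZr; congr (_ + _).
rewrite mulrC; congr (_ / _).
have -> : H *m a *m a^T *m H *m y = dot (H *m a) y *: (H *m a).
  by rewrite -mulmx_outer trmx_mul Hsym !mulmxA.
by rewrite dotZr (dotC y) expr2.
Qed.

(** Let z solve (K - a a^T) z = a and let g = <a, z>. Testing [Kpos] at z gives c |z|^2 <= g, so g
    <= |a|^2 / c by Cauchy-Schwarz; and 1 / (1 - u) = 1 + g <= exp g. *)
Lemma pivot_bound : (Num.sqrt (1 - u))^-1 <= expR (dot a a / c / 2).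
Proof.
have u0 : 0 < 1 - u by rewrite subr_gt0 pivot_lt1.
pose z := (1 - u)^-1 *: (H *m a); pose g := u / (1 - u).
have az : dot a z = g by rewrite dotZr -/u mulrC.
have Kz : dot z (K *m z) - dot a z ^+ 2 = g.
  rewrite az -scalemxAr mulmxA KH mul1mx dotZr [dot z a]dotC az /g.
  by field.
have gz : c * dot z z <= g by rewrite -Kz Kpos.
have g0 : 0 <= g by apply: le_trans gz; rewrite mulr_ge0 ?dot_ge0// ltW.
have ga : g <= dot a a / c.
  rewrite ler_pdivlMr//; have [->|gn0] := eqVneq g 0.
    by rewrite mul0r dot_ge0.
  have gp : 0 < g by rewrite lt0r gn0.
  rewrite -(ler_pM2l gp); have := dot_CauchySchwarz a z; rewrite az => h.
  have := ler_wpM2l (dot_ge0 a) gz.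
  by have := ler_wpM2r (ltW c_gt0) h; nra.
have u1g : (1 - u)^-1 = 1 + g by rewrite /g; field.
have -> : expR (dot a a / c / 2) = Num.sqrt (expR (dot a a / c)).
  rewrite -[LHS]ger0_norm ?expR_ge0// -sqrtr_sqr -expRM_natr.
  by rewrite divfK ?pnatr_eq0.
rewrite -sqrtrV; last exact: ltW.
rewrite u1g ler_wsqrtr//.
by rewrite (le_trans (expR_ge1Dx g))// ler_expR.
Qed.

End pivot.
End dot.

(** * Measurability and exponential moments of Gaussian quadratic forms *)

Lemma measurable_dot (R : realType) d (T : measurableType d) k
    (x y : T -> 'cV[R]_k) :
  (forall i, measurable_fun setT (fun w => x w i 0)) ->
  (forall i, measurable_fun setT (fun w => y w i 0)) ->
  measurable_fun setT (fun w => dot (x w) (y w)).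
Proof.
move=> mx my; under eq_fun do rewrite dotE.
by apply: measurable_sum => i; exact: measurable_funM.
Qed.

Lemma measurable_mulmx (R : realType) d (T : measurableType d) k n
    (A : 'M[R]_(k, n)) (x : T -> 'cV[R]_n) :
  (forall i, measurable_fun setT (fun w => x w i 0)) ->
  forall i, measurable_fun setT (fun w => (A *m x w) i 0).
Proof.
move=> mx i; under eq_fun do rewrite mxE.
by apply: measurable_sum => j; apply: measurable_funM.
Qed.

Lemma measurable_col (R : realType) d (T : measurableType d) n
    (x : 'I_n -> T -> R) :
  (forall i, measurable_fun setT (x i)) ->
  forall i, measurable_fun setT (fun w => (\col_j x j w) i (0 : 'I_1)).
Proof.
move=> mx i; rewrite (_ : (fun w => _) = x i)//.
by apply/funext => w; rewrite mxE.
Qed.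

Lemma measurable_tail_cylinders (R : realType) d (T : measurableType d) n
    (eps : 'I_n.+1 -> T -> R) (i : 'I_n) :
  @measurable_fun _ _ (g_sigma_algebraType (tail_cylinders eps)) R setT
    (eps (lift ord0 i)).
Proof.
move=> _ B mB; rewrite setTI; apply: sub_gen_smallest.
exists (fun j => if j == i then B else setT); first by move=> j; case: ifP.
apply/seteqP; split=> w /=; first by move=> /(_ i I); rewrite eqxx.
by move=> Bw j _; case: eqP => [->|].
Qed.

(* Integrating out the first Gaussian coordinate changes [H] into its pivot
   update [H'], the inverse of [K - a a^T], where [a] is the first column. *)
Lemma gaussian_exp_quadratic_le (R : realType) d (T : measurableType d)
    (P : probability T R) n k (eps : 'I_n -> {RV P >-> R}) (A : 'M[R]_(k, n))
    (H K : 'M[R]_k) (c : R) :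
  iid_normal eps -> 0 < c -> K *m H = 1%:M -> H^T = H ->
  (forall y, c * dot y y <= dot y (K *m y) - dot (A^T *m y) (A^T *m y)) ->
  (\int[P]_w (expR (dot (A *m \col_i eps i w)
                        (H *m (A *m \col_i eps i w)) / 2))%:E
   <= (expR (\tr (A *m A^T) / c / 2))%:E)%E.
Proof.
move=> + c0; elim: n => [|n IHn] in eps A H K * => ie KH Hsym Kpos.
  under eq_integral => w _.
    have -> : A *m \col_i eps i w = 0 by apply/colP => i; rewrite !mxE big_ord0.
    by rewrite dot0l mul0r expR0; over.
  rewrite integral_cst//= probability_setT mule1 lee_fin -expR0 ler_expR.
  by rewrite !divr_ge0 ?trace_mulmx_tr_ge0// ltW.
pose a := col ord0 A; pose A' := col' ord0 A; pose u := dot a (H *m a).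
pose H' := H + (1 - u)^-1 *: (H *m a *m a^T *m H).
pose y (w : T) := A' *m \col_i eps (lift ord0 i) w.
pose v (w : T) := dot (H *m a) (y w); pose q (w : T) := dot (y w) (H *m y w).
have Kpos' z : c * dot z z <= dot z (K *m z) - dot a z ^+ 2.
  apply: le_trans (Kpos z) _; rewrite lerD2l lerN2 dot_tr_col_recl.
  by rewrite lerDl dot_ge0.
have u1 : u < 1 := pivot_lt1 c0 KH Kpos'.
(* The exponent is a quadratic polynomial in the first coordinate, whose coefficients involve only
   the other coordinates. *)
have AE w : dot (A *m \col_i eps i w) (H *m (A *m \col_i eps i w)) / 2 =
    (v w * eps ord0 w + u * eps ord0 w ^+ 2 / 2) + q w / 2.
  rewrite mulmx_col_recl -/a -/A' -/(y w) mulmxDr -scalemxAr.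
  rewrite !(dotDl, dotDr, dotZl, dotZr) -/u -/(q w).
  rewrite [dot a (H *m y w)]dotC dot_mulmx Hsym !(dotC (y w) (H *m a)) -/(v w).
  by field.
under eq_integral do rewrite AE expRD.
(* [T2] is [T] with the coarser sigma-algebra of the remaining coordinates. The identity into [T2]
   then plays the role of the variable independent of [eps ord0]. *)
pose T2 := g_sigma_algebraType (tail_cylinders eps).
pose f (p : measurableTypeR R * T2) : \bar R :=
  (expR (v p.2 * p.1 + u * p.1 ^+ 2 / 2) * expR (q p.2 / 2))%:E.
have my i : measurable_fun [set: T2] (fun w => y w i 0).
  apply: measurable_mulmx; apply: measurable_col => j.
  exact: measurable_tail_cylinders.
have mv : measurable_fun [set: T2] v.
  by apply: measurable_dot.
have mq : measurable_fun [set: T2] q.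
  by apply: measurable_dot => //; exact: measurable_mulmx.
have mf : measurable_fun setT f.
  apply/measurable_EFinP; apply: measurable_funM; apply: measurableT_comp => //.
    apply: measurable_funD.
      by apply: measurable_funM => //; exact: measurableT_comp.
    by do 2 apply: measurable_funM => //; exact: measurable_funX.
  by apply: measurable_funM => //; exact: measurableT_comp.
have f0 p : (0 <= f p)%E by rewrite lee_fin mulr_ge0// expR_ge0.
have mid : @measurable_fun _ _ T T2 setT id.
  move=> _ B mB; rewrite setTI; apply: smallest_sub mB.
    exact: sigma_algebra_measurable.
  by move=> _ [C mC <-]; apply: fin_bigcap_measurable => // i _;
    rewrite -[X in measurable X]setTI; exact: measurable_funP.
have ind := @ge0_integral_indep R _ _ _ T _ T2 P
  (normal_prob 0 1) (eps ord0) id f _ mid mf f0 _.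
rewrite [leLHS]ind; last 2 first.
- exact: (measurable_funP (eps ord0)).
- by move=> B C mB mC; apply: iid_normal_head_indep.
have fE w : (\int[normal_prob 0 1]_t f (t, w) =
    (Num.sqrt (1 - u))^-1%:E * (expR (dot (y w) (H' *m y w) / 2))%:E)%E.
  under eq_integral => t _ do rewrite /f /= EFinM.
  rewrite ge0_integralZr//.
    rewrite gaussian_integral_exp_quadratic// -!EFinM; congr EFin.
    rewrite -[LHS]mulrA -expRD; congr (_ * expR _).
    by rewrite -mulrDl pivot_form// addrC.
  exact: measurable_expR_quadratic.
under eq_integral do rewrite fE.
have myP i : measurable_fun [set: T] (fun w => y w i 0).
  by apply: measurable_mulmx; apply: measurable_col => j; exact: measurable_funP.
rewrite ge0_integralZl//; last first.
  apply/measurable_EFinP; apply: measurableT_comp => //.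
  apply: measurable_funM => //; apply: measurable_dot => //.
  exact: measurable_mulmx.
(* The trace splits by columns: [pivot_bound] pays for the first one, the induction hypothesis for
   the others. *)
apply: (@le_trans _ _ ((expR (dot a a / c / 2))%:E *
    (expR (\tr (A' *m A'^T) / c / 2))%:E)%E); last first.
  by rewrite -EFinM -expRD -!mulrDl -trace_col_recl.
apply: lee_pmul.
- by rewrite lee_fin invr_ge0 sqrtr_ge0.
- by apply: integral_ge0 => w _; rewrite lee_fin expR_ge0.
- by rewrite lee_fin; exact: pivot_bound c0 KH Kpos'.
apply: (IHn (fun i => eps (lift ord0 i)) A' H' (K - a *m a^T)).
- exact: iid_normal_behead.
- exact: pivot_inverse c0 KH Kpos'.
- exact: pivot_sym.
(* Removing the column [a] from A and a a^T from K leaves K - A A^T unchanged, so the same [c]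
   serves at every stage. *)
- move=> z; apply: le_trans (Kpos z) _; rewrite dot_tr_col_recl -/a -/A'.
  by rewrite mulmxBl mulmx_outer dotBr dotZr (dotC z a) opprD addrA expr2.
Qed.

(** With z = A^T y, |z|^2 = <y, A z>, so Cauchy-Schwarz gives |z|^4 <= r |y|^2 |z|^2; then |z|^2
    cancels. *)
Lemma opnorm_tr_le (R : realType) k n (A : 'M[R]_(k, n)) (r : R) :
  0 <= r -> (forall x, dot (A *m x) (A *m x) <= r * dot x x) ->
  forall y, dot (A^T *m y) (A^T *m y) <= r * dot y y.
Proof.
move=> r0 Ar y; set z := A^T *m y; have [->|z0] := eqVneq z 0.
  by rewrite dot0l mulr_ge0// dot_ge0.
have zE : dot z z = dot y (A *m z).
  by rewrite -[A in RHS]trmxK -dot_mulmx.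
rewrite -(ler_pM2r (dot_gt0 z0)) -expr2 {1}zE.
apply: le_trans (dot_CauchySchwarz _ _) _.
by rewrite mulrAC mulrC ler_wpM2r// dot_ge0.
Qed.

(** The scalar case H = 2 l I: K - A A^T is bounded below by 1 / (2 l) - r, which is positive since
    2 l r < 1. *)
Lemma gaussian_exp_norm_le (R : realType) d (T : measurableType d)
    (P : probability T R) n k (eps : 'I_n -> {RV P >-> R}) (A : 'M[R]_(k, n))
    (l r : R) :
  iid_normal eps -> 0 < l -> 0 <= r -> 2 * l * r < 1 ->
  (forall x, dot (A *m x) (A *m x) <= r * dot x x) ->
  (\int[P]_w (expR (l * dot (A *m \col_i eps i w) (A *m \col_i eps i w)))%:E
   <= (expR (l * \tr (A *m A^T) / (1 - 2 * l * r)))%:E)%E.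
Proof.
move=> ie l0 r0 lr Ar; pose c := (2 * l)^-1 - r.
have cE : c = (1 - 2 * l * r) / (2 * l) by rewrite /c; field; lra.
have c0 : 0 < c by rewrite cE divr_gt0 ?mulr_gt0// subr_gt0.
have := @gaussian_exp_quadratic_le _ _ _ P n k eps A (2 * l)%:M (2 * l)^-1%:M c
  ie c0 _ (tr_scalar_mx _ _) _.
have -> : l * \tr (A *m A^T) / (1 - 2 * l * r) = \tr (A *m A^T) / c / 2.
  by rewrite cE; field; lra.
under eq_integral => w _.
  rewrite mul_scalar_mx dotZr (_ : 2 * l * _ / 2 =
    l * dot (A *m \col_i eps i w) (A *m \col_i eps i w)); last by field.
  over.
apply; first by rewrite -scalar_mxM mulVf// mulf_neq0// gt_eqF.
move=> y; rewrite mul_scalar_mx dotZr mulrBl lerD2l lerN2.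
exact: opnorm_tr_le.
Qed.

(** * Normalized norm and spectral norm *)

Lemma nnormE (R : realType) n (x : 'cV[R]_n) :
  nnorm x = Num.sqrt (n%:R^-1 * dot x x).
Proof.
by rewrite /nnorm dotE; congr (Num.sqrt (_ * _)); apply: eq_bigr => i _;
  rewrite expr2.
Qed.

Lemma nnorm_sqr (R : realType) n (x : 'cV[R]_n) :
  nnorm x ^+ 2 = n%:R^-1 * dot x x.
Proof. by rewrite nnormE sqr_sqrtr// mulr_ge0 ?invr_ge0 ?dot_ge0. Qed.

(** Cauchy-Schwarz on each row. This Frobenius bound makes the ratios defining [spectral_norm]
    bounded, so that their [sup] is a true upper bound. *)
Lemma dot_mulmx_le_trace (R : realType) k n (A : 'M[R]_(k, n)) x :
  dot (A *m x) (A *m x) <= \tr (A *m A^T) * dot x x.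
Proof.
rewrite dotE /mxtrace mulr_suml; apply: ler_sum => i _.
have -> : (A *m x) i 0 = dot (row i A)^T x.
  by rewrite dotE mxE; apply: eq_bigr => j _; rewrite !mxE.
have -> : (A *m A^T) i i = dot (row i A)^T (row i A)^T.
  by rewrite dotE mxE; apply: eq_bigr => j _; rewrite !mxE.
by rewrite -expr2 dot_CauchySchwarz.
Qed.

Section spectral_norm.
Variables (R : realType) (n : nat) (A : 'M[R]_n).
Hypothesis n_gt0 : (0 < n)%N.

Let nnorm_gt0 (x : 'cV[R]_n) : x != 0 -> 0 < nnorm x.
Proof.
by move=> x0; rewrite nnormE sqrtr_gt0 mulr_gt0 ?invr_gt0 ?ltr0n ?dot_gt0.
Qed.

Lemma spectral_norm_ub (x : 'cV[R]_n) : nnorm (A *m x) <= spectral_norm A * nnorm x.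
Proof.
have [->|x0] := eqVneq x 0.
  by rewrite mulmx0 nnormE dot0l mulr0 sqrtr0 mulr0.
rewrite -ler_pdivrMr ?nnorm_gt0//; apply: sup_upper_bound; last by exists x.
split; first by exists (nnorm (A *m x) / nnorm x), x.
exists (Num.sqrt (\tr (A *m A^T))) => _ [y y0 <-].
rewrite ler_pdivrMr ?nnorm_gt0// !nnormE -sqrtrM ?trace_mulmx_tr_ge0//.
by rewrite ler_wsqrtr// mulrCA ler_wpM2l ?invr_ge0// dot_mulmx_le_trace.
Qed.

Lemma spectral_norm_ge0 : 0 <= spectral_norm A.
Proof.
pose x : 'cV[R]_n := const_mx 1.
have x0 : x != 0.
  by apply/eqP => /colP /(_ (Ordinal n_gt0))/eqP; rewrite !mxE oner_eq0.
rewrite -(pmulr_lge0 _ (nnorm_gt0 x0)); apply: le_trans (spectral_norm_ub x).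
by rewrite nnormE sqrtr_ge0.
Qed.

Lemma dot_mulmx_le_spectral_norm (x : 'cV[R]_n) :
  dot (A *m x) (A *m x) <= spectral_norm A ^+ 2 * dot x x.
Proof.
have n0 : 0 < (n%:R^-1 : R) by rewrite invr_gt0 ltr0n.
rewrite -(ler_pM2l n0) mulrCA -!nnorm_sqr -exprMn ler_sqr ?nnegrE.
- exact: spectral_norm_ub.
- by rewrite nnormE sqrtr_ge0.
- by rewrite mulr_ge0 ?spectral_norm_ge0// nnormE sqrtr_ge0.
Qed.

Lemma spectral_norm_gt0 : A != 0 -> 0 < spectral_norm A.
Proof.
rewrite lt0r spectral_norm_ge0 andbT; apply: contraNN => /eqP rho0.
apply/eqP/matrixP => i j; rewrite mxE.
have := dot_mulmx_le_spectral_norm (delta_mx j 0).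
rewrite rho0 expr0n mul0r => h.
have : dot (A *m delta_mx j 0) (A *m delta_mx j 0) == 0.
  by rewrite eq_le h dot_ge0.
by rewrite dot_eq0 -colE => /eqP/colP/(_ i); rewrite !mxE.
Qed.

End spectral_norm.

(** * Orthogonal projections and residuals *)

Section orthproj.
Variables (R : realType) (n : nat) (U : {vspace 'cV[R]_n}).
Hypothesis n_gt0 : (0 < n)%N.

(** Write Q for the projection. The entries of (I - Q)^T Q are inner products of e_i - Q e_i with Q
    e_j, which lies in [U]. Symmetry and idempotence both follow. *)
Lemma orthproj_gram : (orthproj U)^T *m orthproj U = orthproj U.
Proof.
suff: (1%:M - orthproj U)^T *m orthproj U = 0.
  by rewrite linearB /= trmx1 mulmxBl mul1mx => /eqP; rewrite subr_eq0 => /eqP.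
apply/matrixP => i j; rewrite [RHS]mxE.
have [_ /(_ _ (orthprojP U (delta_mx j 0)).1)] := orthprojP U (delta_mx i 0).
move/eqP; rewrite mulf_eq0 invr_eq0 pnatr_eq0 (gtn_eqF n_gt0) /= => /eqP.
rewrite -dotE -{1}(mul1mx (delta_mx i 0)) -mulmxBl => <-.
rewrite dot_mulmx mulmxA -colE /dot trmx_delta -rowE.
by rewrite !mxE.
Qed.

Lemma orthproj_sym : (orthproj U)^T = orthproj U.
Proof. by rewrite -{1}orthproj_gram trmx_mul trmxK orthproj_gram. Qed.

Lemma orthproj_idem : orthproj U *m orthproj U = orthproj U.
Proof. by rewrite -{1}orthproj_sym orthproj_gram. Qed.

End orthproj.

(* Vanishes when [r = 0], since [0^-1 = 0]. *)
Definition unitv (R : realType) n (r : 'cV[R]_n) : 'cV[R]_n :=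
  (Num.sqrt (dot r r))^-1 *: r.

Lemma dot_unitv (R : realType) n (r w : 'cV[R]_n) :
  dot r w = Num.sqrt (dot r r) * dot (unitv r) w.
Proof.
rewrite dotZl mulrA; have [->|r0] := eqVneq r 0; first by rewrite !dot0l mulr0.
by rewrite divff ?mul1r// gt_eqF// sqrtr_gt0 dot_gt0.
Qed.

Lemma dot_unitv_le1 (R : realType) n (r : 'cV[R]_n) :
  dot (unitv r) (unitv r) <= 1.
Proof.
rewrite /unitv dotZl dotZr; have [->|r0] := eqVneq r 0.
  by rewrite dot0l !mulr0.
rewrite mulrA -invfM -expr2 sqr_sqrtr ?dot_ge0// mulVf//.
by rewrite gt_eqF// dot_gt0.
Qed.

Section projection.
Variables (R : realType) (n : nat) (Q : 'M[R]_n).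
Hypotheses (Qsym : Q^T = Q) (Qidem : Q *m Q = Q).

Lemma dot_proj (x y : 'cV[R]_n) : dot (Q *m x) (Q *m y) = dot x (Q *m y).
Proof. by rewrite dot_mulmx Qsym mulmxA Qidem. Qed.

Lemma dot_residual_proj (x y : 'cV[R]_n) : dot (x - Q *m x) (Q *m y) = 0.
Proof. by rewrite dotBl dot_proj subrr. Qed.

Lemma dot_residual (x : 'cV[R]_n) :
  dot (x - Q *m x) (x - Q *m x) = dot x x - dot (Q *m x) (Q *m x).
Proof. by rewrite dotBr dot_residual_proj dotBl dot_proj (dotC x) subr0. Qed.

Lemma dot_proj_le (x : 'cV[R]_n) : dot (Q *m x) (Q *m x) <= dot x x.
Proof. by rewrite -subr_ge0 -dot_residual dot_ge0. Qed.

(** The residual of [s] is orthogonal to the image of [Q], so its product with the residual of [w]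
    is its product with [w]. The term [dot w w] is free of [Q] and cancels between two models. *)
Lemma residual_observation (s w : 'cV[R]_n) :
  dot (s + w - Q *m (s + w)) (s + w - Q *m (s + w)) =
  dot (s - Q *m s) (s - Q *m s) + 2 * dot (s - Q *m s) w + dot w w
    - dot (Q *m w) (Q *m w).
Proof.
have rw : dot (s - Q *m s) (w - Q *m w) = dot (s - Q *m s) w.
  by rewrite dotBr dot_residual_proj subr0.
have -> : s + w - Q *m (s + w) = (s - Q *m s) + (w - Q *m w).
  by rewrite mulmxDr opprD addrACA.
rewrite dotDl !(dotDr (s - _)) (dotC (w - _) (s - _)) rw.
by rewrite (dot_residual w); ring.
Qed.

Lemma error_observation (s w : 'cV[R]_n) :
  dot (s - Q *m (s + w)) (s - Q *m (s + w)) =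
  dot (s - Q *m s) (s - Q *m s) + dot (Q *m w) (Q *m w).
Proof.
have := dot_residual_proj s w; rewrite mulmxDr opprD addrA.
move: (s - Q *m s) (Q *m w) => r g rg.
by rewrite dotBr !dotBl (dotC g r) rg subr0 sub0r opprK.
Qed.

End projection.

(** * Deterministic comparison of two models *)

(** The criterion bounds the squared bias D at [Q]. Half of D absorbs the cross term with the noise,
    and [a <= 1 / 2] makes the other half dominate a D. The share a |Q w|^2 of the loss produces the
    factor [1 + a]. *)
Lemma selection_error_le (R : realType) n (Q0 Q : 'M[R]_n) (s w : 'cV[R]_n)
    (p0 p a : R) :
  Q0^T = Q0 -> Q0 *m Q0 = Q0 -> Q^T = Q -> Q *m Q = Q -> 0 <= a <= 1 / 2 ->
  dot (s + w - Q *m (s + w)) (s + w - Q *m (s + w)) + p <=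
  dot (s + w - Q0 *m (s + w)) (s + w - Q0 *m (s + w)) + p0 ->
  a * dot (s - Q *m (s + w)) (s - Q *m (s + w)) <=
  3 / 2 * dot (s - Q0 *m s) (s - Q0 *m s) + p0
    + 2 * dot (unitv (s - Q0 *m s)) w ^+ 2
    + ((1 + a) * dot (Q *m w) (Q *m w) + 2 * dot (unitv (s - Q *m s)) w ^+ 2 - p).
Proof.
move=> Q0s Q0i Qs Qi /andP[a0 a1].
rewrite !residual_observation// error_observation//.
rewrite !(dot_unitv (_ - _) w).
set D := dot (s - Q *m s) _; set D0 := dot (s - Q0 *m s) _.
set Z := dot (unitv (s - Q *m s)) w; set Z0 := dot (unitv (s - Q0 *m s)) w.
have D_ge0 : 0 <= D by exact: dot_ge0.
have := sqr_sqrtr D_ge0; have := sqr_sqrtr (dot_ge0 (s - Q0 *m s)); rewrite -/D0.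
set x0 := Num.sqrt D0; set x := Num.sqrt D => <- xD.
have V0 := dot_ge0 (Q0 *m w); have aD : a * D <= D / 2 by nra.
(* AM-GM in the form -2 x Z <= x^2 / 2 + 2 Z^2, and likewise below for the fixed model. *)
have sq : 0 <= (x + 2 * Z) ^+ 2 by exact: sqr_ge0.
have sq0 : 0 <= (x0 - 2 * Z0) ^+ 2 by exact: sqr_ge0.
by move: sq sq0; rewrite !sqrrD sqrrN xD mulrDr; nra.
Qed.

(** The square of a linear form is written as the squared norm of a one-row matrix applied to [x],
    so that one exponential bound serves both kinds of noise term. *)
Lemma selection_error_noise_le (R : realType) n (Q0 Q Pn : 'M[R]_n)
    (s x : 'cV[R]_n) (sg p0 p a : R) (y := s + sg *: (Pn *m x))
    (V := fun B : 'M[R]_n => dot (B *m Pn *m x) (B *m Pn *m x))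
    (Z := fun B : 'M[R]_n => dot ((unitv (s - B *m s))^T *m Pn *m x)
                                 ((unitv (s - B *m s))^T *m Pn *m x)) :
  Q0^T = Q0 -> Q0 *m Q0 = Q0 -> Q^T = Q -> Q *m Q = Q -> 0 <= a <= 1 / 2 ->
  dot (y - Q *m y) (y - Q *m y) + p <= dot (y - Q0 *m y) (y - Q0 *m y) + p0 ->
  a * dot (s - Q *m y) (s - Q *m y) <=
  3 / 2 * dot (s - Q0 *m s) (s - Q0 *m s) + p0 + 2 * (sg ^+ 2 * Z Q0)
    + ((1 + a) * (sg ^+ 2 * V Q) + 2 * (sg ^+ 2 * Z Q) - p).
Proof.
move=> Q0s Q0i Qs Qi a01 /(selection_error_le Q0s Q0i Qs Qi a01).
have ZE B : dot (unitv (s - B *m s)) (sg *: (Pn *m x)) ^+ 2 = sg ^+ 2 * Z B.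
  by rewrite dotZr exprMn /Z [in RHS]dotE big_ord1 -expr2 /dot mulmxA.
have VE B : dot (B *m (sg *: (Pn *m x))) (B *m (sg *: (Pn *m x))) = sg ^+ 2 * V B.
  by rewrite -scalemxAr dotZl dotZr mulrA -expr2 /V mulmxA.
by rewrite !ZE VE.
Qed.

Lemma penalized_minimizer_dot (R : realType) n (M : Type)
    (S : M -> {vspace 'cV[R]_n}) (pen : M -> R) (y : 'cV[R]_n) (m0 m : M)
    (r := fun m => y - orthproj (S m) *m y) :
  (0 < n)%N -> is_penalized_minimizer S pen y m0 ->
  dot (r m0) (r m0) + n%:R * pen m0 <= dot (r m) (r m) + n%:R * pen m.
Proof.
move=> n0 /(_ m); have n0R : 0 < n%:R :> R by rewrite ltr0n.
rewrite !nnorm_sqr -(ler_pM2l n0R) !(mulrDr n%:R) !mulrA divff ?mul1r//.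
by rewrite gt_eqF.
Qed.

(** Here [q] is the part of the penalty [p] that carries the weight; the fixed model costs half of
    it, turning [p] into at most 3/2 p. Adding [g1] gives both models noise terms of the same
    shape. *)
Lemma penalized_bound_combine (R : realType) (k a D p z u q g1 g2 h B c : R) :
  0 <= k -> 0 <= B -> 0 <= g1 -> q <= p ->
  a <= 3 / 2 * D + p + z + u -> u <= B * h -> z <= q / 2 + B * g2 ->
  3 / 2 * k * (D + p) <= c ->
  k * a <= c + k * B * (g1 + g2) + k * B * h.
Proof.
move=> k0 B0 g10 qp au uh zq Dc; have Bg := mulr_ge0 B0 g10.
have : a <= 3 / 2 * (D + p) + B * (g1 + g2) + B * h by lra.
move=> /(ler_wpM2l k0) /le_trans; apply.
have -> : k * (3 / 2 * (D + p) + B * (g1 + g2) + B * h) =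
  3 / 2 * k * (D + p) + k * B * (g1 + g2) + k * B * h by ring.
by lra.
Qed.

(** * Integration over a random choice of model *)

(** The integral of a nonnegative function is a supremum over the simple functions below it, hence
    monotone on arbitrary functions, such as a loss at a selected model. *)
Lemma le_ge0_integral (R : realType) d (T : measurableType d)
    (mu : {measure set T -> \bar R}) (f g : T -> \bar R) :
  (forall w, (0 <= f w)%E) -> (forall w, (f w <= g w)%E) ->
  (\int[mu]_w f w <= \int[mu]_w g w)%E.
Proof.
move=> f0 fg; have g0 w : (0 <= g w)%E := le_trans (f0 w) (fg w).
rewrite !ge0_integralTE//; apply: le_ereal_sup => _ [h hf <-].
by exists h => // w; exact: le_trans (hf w) (fg w).
Qed.

(* [sel] need not be measurable; the bound goes through the measurable majorant
   [a + \sum_m 2 G m]. *)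
Lemma expectation_selection_le (R : realType) d (T : measurableType d)
    (P : probability T R) (M : countType) (f : T -> R) (a : R)
    (G : M -> T -> R) (b : M -> R) (c : R) (m0 : M) (sel : T -> M) :
  0 <= a -> 0 <= c -> (forall m, 0 <= b m) -> (forall w, 0 <= f w) ->
  (forall m w, 0 <= G m w) ->
  (forall m, measurable_fun setT (G m)) ->
  (forall m, (\int[P]_w (G m w)%:E <= (c * b m)%:E)%E) ->
  (forall w, f w <= a + G m0 w + G (sel w) w) ->
  ('E_P[f] <= a%:E + (2 * c)%:E * \esum_(m in [set: M]) (b m)%:E)%E.
Proof.
move=> a0 c0 b0 f0 G0 mG Gb fG.
(* Models are enumerated by their codes; a code that represents no model contributes 0. *)
pose dom k := isSome (@pickle_inv M k).
pose e k := odflt m0 (@pickle_inv M k).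
pose F k w := if dom k then (2 * G (e k) w)%:E else 0%E.
have F0 k w : (0 <= F k w)%E by rewrite /F; case: ifP; rewrite // lee_fin mulr_ge0.
have mF k : measurable_fun setT (F k).
  rewrite /F; case: (dom k) => //; apply/measurable_EFinP.
  by apply: measurable_funM.
have GF m w : ((2 * G m w)%:E <= \sum_(0 <= k <oo) F k w)%E.
  apply: le_trans (nneseries_lim_ge (pickle m).+1 (fun k _ _ => F0 k w)).
  rewrite big_nat_recr//=.
  have -> : F (pickle m) w = (2 * G m w)%:E by rewrite /F /dom /e pickleK_inv.
  by rewrite leeDr//; apply: sume_ge0.
rewrite unlock.
apply: (@le_trans _ _ (\int[P]_w (a%:E + \sum_(0 <= k <oo) F k w))%E).
  apply: le_ge0_integral => w; first by rewrite lee_fin.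
  apply: le_trans (_ : (a + (G m0 w + G (sel w) w))%:E <= _)%E.
    by rewrite lee_fin addrA.
  (* The two terms sum to at most twice the larger. The factor 2 is there because [m0] and [sel w]
     may coincide, while the series counts each model once. *)
  rewrite EFinD leeD2l//; have [h|h] := leP (G m0 w) (G (sel w) w).
    by apply: le_trans (GF (sel w) w); rewrite lee_fin; lra.
  by apply: le_trans (GF m0 w); rewrite lee_fin; lra.
rewrite ge0_integralD//; last 2 first.
- by move=> w _; exact: nneseries_ge0.
- exact: ge0_emeasurable_sum.
rewrite integral_cst//= probability_setT mule1 leeD2l//.
rewrite integral_nneseries//.
have domE : set_bij [set k | dom k] [set: M] e.
  split => //.
  - move=> k l; rewrite !inE /= /dom /e => dk dl.
    have := @pickle_invK M k; have := @pickle_invK M l.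
    by case: pickle_inv dk => // x _; case: pickle_inv dl => // y _ /= <- <- ->.
  - by move=> m _; exists (pickle m); rewrite /= /dom /e pickleK_inv.
rewrite (reindex_esum _ _ _ _ domE) -nneseries_esum; last by move=> k _; rewrite lee_fin.
rewrite -nneseriesZl; last by move=> k _; rewrite lee_fin.
rewrite [leRHS]eseries_mkcond; apply: lee_nneseries => k _.
  by move=> _; apply: integral_ge0.
rewrite /F; case: ifP => // _; last by rewrite integral0.
under eq_integral do rewrite EFinM.
rewrite ge0_integralZl//.
- by rewrite EFinM -muleA lee_wpmul2l// -EFinM.
- exact/measurable_EFinP.
- by move=> w _; rewrite lee_fin.
Qed.

(** If the remainder [X] is infinite, so is the right side, the infimum being nonnegative. Otherwise
    [X] is subtracted and [C] divided out before taking the infimum. *)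
Lemma le_affine_ereal_inf (R : realType) (M : Type) (C : R) (c : M -> R)
    (E X : \bar R) :
  0 < C -> (forall m, 0 <= c m) -> (0 <= X)%E ->
  (forall m, E <= (C * c m)%:E + X)%E ->
  (E <= C%:E * ereal_inf (range (fun m => (c m)%:E)) + X)%E.
Proof.
move=> C0 c0 X0 Ec; have inf0 : (0 <= ereal_inf (range (fun m => (c m)%:E)))%E.
  by apply: le_ereal_inf_tmp => _ [m _ <-]; rewrite lee_fin.
have [Xfin|] := boolP (X \is a fin_num); last first.
  rewrite ge0_fin_numE// -leNgt leye_eq => /eqP ->.
  by rewrite addey ?leey// gt_eqF// (lt_le_trans ltNy0)// mule_ge0// lee_fin ltW.
rewrite -leeBlDr// -lee_pdivrMl//; apply: le_ereal_inf_tmp => _ [m _ <-].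
by rewrite lee_pdivrMl// leeBlDr// -EFinM.
Qed.

(** * Exponential deviation of the noise terms *)

Section deviation.
Variables (R : realType) (d : measure_display) (T : measurableType d).
Variables (P : probability T R) (n k : nat) (eps : 'I_n -> {RV P >-> R}).
Variables (A : 'M[R]_(k, n)) (r b e : R).
Hypotheses (ie : iid_normal eps) (r0 : 0 < r) (b0 : 0 < b) (b1 : 2 * b < 1).
Hypothesis Ar : forall x, dot (A *m x) (A *m x) <= r * dot x x.

(** Dominates the excess of the scaled form over the threshold [e], by [x <= expR x]. The scale
    [b / r] turns the moment condition into [2 * b < 1]. *)
Definition deviation w :=
  expR (b / r * dot (A *m \col_i eps i w) (A *m \col_i eps i w) - e).

Lemma measurable_deviation : measurable_fun setT deviation.
Proof.
have mA i : measurable_fun setT (fun w => (A *m \col_i eps i w) i 0).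
  by apply: measurable_mulmx; apply: measurable_col => j; exact: measurable_funP.
apply: measurableT_comp => //; apply: measurable_funB => //.
by apply: measurable_funM => //; exact: measurable_dot.
Qed.

Lemma integral_deviation_le :
  (\int[P]_w (deviation w)%:E <=
   (expR (b / r * \tr (A *m A^T) / (1 - 2 * b) - e))%:E)%E.
Proof.
rewrite /deviation; under eq_integral do rewrite expRD EFinM muleC.
have mA i : measurable_fun setT (fun w => (A *m \col_i eps i w) i 0).
  by apply: measurable_mulmx; apply: measurable_col => j; exact: measurable_funP.
rewrite ge0_integralZl//; last first.
  apply/measurable_EFinP/measurableT_comp => //.
  by apply: measurable_funM => //; exact: measurable_dot.
rewrite muleC expRD EFinM lee_wpmul2r// ?lee_fin ?expR_ge0//.
have br : 2 * (b / r) * r = 2 * b by field; rewrite gt_eqF.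
have := gaussian_exp_norm_le ie (divr_gt0 b0 r0) (ltW r0) _ Ar.
by rewrite br; apply.
Qed.

End deviation.

(** Cyclicity of the trace and Q^T Q = Q: the trace term takes the form that occurs in the
    exponential moment. *)
Lemma trace_termE (R : realType) n (Pn : 'M[R]_n) (U : {vspace 'cV[R]_n}) :
  (0 < n)%N ->
  trace_term Pn U = \tr ((orthproj U *m Pn) *m (orthproj U *m Pn)^T).
Proof.
move=> n0; rewrite mxtrace_mulC trmx_mul mulmxA /trace_term; congr (\tr (_ *m _)).
by rewrite -[in RHS]mulmxA orthproj_gram.
Qed.

(** * Constants depending on the slack in the penalty *)

Section constants.
Variables (R : realType) (th : R).
Hypothesis th0 : 0 < th.

(** [al] is the fraction of the loss that is kept, [ka] the scale of the exponents; both are small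
    enough for the slack [th] to absorb their cost. *)
Let al := th / (2 * (1 + th)).
Let ka := th / (8 * (1 + th)).

Let th1 : 0 < 1 + th. Proof. by rewrite addr_gt0. Qed.

Lemma alpha_bound : 0 < al <= 1 / 2.
Proof.
rewrite divr_gt0 ?mulr_gt0//= ler_pdivrMr ?mulr_gt0//.
by have := th0; lra.
Qed.

Lemma kappa_bound : 0 < ka <= 1 / 8.
Proof.
rewrite divr_gt0 ?mulr_gt0//= ler_pdivrMr ?mulr_gt0//.
by have := th0; lra.
Qed.

(** The exponential moment inflates the trace by 1 / (1 - 2 ka (1 + al)); even so, (1 + al) times
    the trace stays below its multiple by [1 + th] in the penalty. *)
Lemma alpha_kappa_bound :
  2 * (ka * (1 + al)) < 1 /\
  ka * (1 + al) / (1 - 2 * (ka * (1 + al))) <= ka * (1 + th).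
Proof.
have /andP[al0 al1] := alpha_bound; have /andP[ka0 ka1] := kappa_bound.
have alE : al * (1 + th) = th / 2 by rewrite /al; field; rewrite gt_eqF.
have kaE : ka * (1 + th) = th / 8 by rewrite /ka; field; rewrite gt_eqF.
have lt1 : 2 * (ka * (1 + al)) < 1 by nra.
split=> //; rewrite ler_pdivrMr ?subr_gt0// -[leRHS]mulrA ler_wpM2l//;
  first exact: ltW.
have -> : (1 + th) * (1 - 2 * (ka * (1 + al))) =
  1 + th - 2 * (1 + al) * (ka * (1 + th)) by ring.
rewrite kaE; have alth : al <= th / 2 by rewrite -alE; nra.
by have := th0; nra.
Qed.

(** The share [1 + th] of the penalty compensates the quadratic form [V], and the weight [l] is
    split equally between [V] and [Z]; then [x <= expR x] applies to each part. *)
Lemma excess_le_deviation (s2 r V Z t l p : R) :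
  0 < s2 -> 0 < r -> (1 + th + l) * t * s2 <= p ->
  (1 + al) * (s2 * V) + 2 * (s2 * Z) - p <=
  s2 * r / ka * (expR (ka * (1 + al) / r * V -
      (ka * (1 + th) * t / r + ka / 2 * l * t / r)) +
    expR (2 * ka / r * Z - ka / 2 * l * t / r)).
Proof.
move=> s20 r0 pen_ge; have /andP[ka0 _] := kappa_bound.
have B0 : 0 < s2 * r / ka by apply: divr_gt0 => //; exact: mulr_gt0.
have leexp (x : R) : x <= expR x.
  by apply: le_trans (expR_ge1Dx x); rewrite lerDr.
apply: le_trans (ler_wpM2l (ltW B0) (lerD (leexp _) (leexp _))).
apply: le_trans (lerB (lexx _) pen_ge) _; rewrite le_eqVlt; apply/orP; left.
by apply/eqP; field; rewrite !gt_eqF.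
Qed.

(** At the fixed model no penalty is subtracted, so half of the weighted trace is added back to
    center the exponent. *)
Lemma square_le_deviation (s2 r Z t l : R) :
  0 < s2 -> 0 < r ->
  2 * (s2 * Z) <= l * t * s2 / 2 +
  s2 * r / ka * expR (2 * ka / r * Z - ka / 2 * l * t / r).
Proof.
move=> s20 r0; have /andP[ka0 _] := kappa_bound.
have B0 : 0 < s2 * r / ka by apply: divr_gt0 => //; exact: mulr_gt0.
have leexp (x : R) : x <= expR x.
  by apply: le_trans (expR_ge1Dx x); rewrite lerDr.
rewrite -lerBlDl; apply: le_trans (ler_wpM2l (ltW B0) (leexp _)).
by rewrite le_eqVlt; apply/orP; left; apply/eqP; field; rewrite !gt_eqF.
Qed.

Lemma deviation_exponent_le (r t x : R) : 0 < r -> 0 <= t ->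
  expR (ka * (1 + al) / r * t / (1 - 2 * (ka * (1 + al))) -
    (ka * (1 + th) * t / r + x)) <= expR (- x).
Proof.
move=> r0 t0; rewrite ler_expR opprD addrA gerDr.
have [lt1 h] := alpha_kappa_bound.
have -> : ka * (1 + al) / r * t / (1 - 2 * (ka * (1 + al))) =
  ka * (1 + al) / (1 - 2 * (ka * (1 + al))) * (t / r).
  by field; rewrite gt_eqF//= gt_eqF// subr_gt0.
rewrite subr_le0 -[leRHS]mulrA; apply: ler_wpM2r h.
by apply: divr_ge0 => //; exact: ltW.
Qed.

(** A one-row form has trace at most [r]; since [ka <= 1 / 8], its mean raises the exponent by at
    most 1. *)
Lemma deviation_exponent_unit_le (r t x : R) : 0 < r -> t <= r ->
  expR (2 * ka / r * t / (1 - 2 * (2 * ka)) - x) <= expR 1 * expR (- x).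
Proof.
move=> r0 tr; have /andP[ka0 ka1] := kappa_bound.
rewrite -expRD ler_expR lerD2r.
have k1 : 0 < 1 - 2 * (2 * ka) by lra.
rewrite ler_pdivrMr// mul1r.
have : 2 * ka / r * t <= 2 * ka.
  have -> : 2 * ka / r * t = 2 * ka * (t / r) by field; rewrite gt_eqF.
  apply: ler_piMr; last by rewrite ler_pdivrMr ?mul1r.
  by apply: mulr_ge0 => //; exact: ltW.
by lra.
Qed.

End constants.

(** * Assembly of the oracle inequality *)

Theorem theorem2p1 (R : realType) (theta : R) (theta_gt0 : 0 < theta) :
  exists C C' C'' : R,
    [/\ 1 < C, 0 < C' & 0 < C''] /\
    forall (n : nat) (Pn : 'M[R]_n) (s : 'cV[R]_n) (sigma : R)
      (d : measure_display) (T : measurableType d) (P : probability T R)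
      (eps : 'I_n -> {RV P >-> R})
      (M : countType) (S : M -> {vspace 'cV[R]_n}) (L pen : M -> R)
      (mhat : T -> M),
      let Y := observation Pn s sigma eps in
      let stilde := fun w => orthproj (S (mhat w)) *m Y w in
      Pn != 0 ->
      s \in im_mx Pn ->
      0 < sigma ->
      standard_gaussian_vector eps ->
      (forall m, (S m <= im_mx Pn)%VS) ->
      (forall m, 0 <= L m) ->
      (forall m, 0 <= pen m) ->
      (forall m, (1 + theta + L m) * (trace_term Pn (S m) / n%:R) * sigma ^+ 2
                 <= pen m) ->
      (forall w, is_penalized_minimizer S pen (Y w) (mhat w)) ->
      ('E_P[fun w => (nnorm (s - stilde w) ^+ 2)%R]
       <= C%:E * ereal_inf (range (fun m =>
            (nnorm (s - orthproj (S m) *m s) ^+ 2 + pen m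
             - trace_term Pn (S m) / n%:R * sigma ^+ 2)%:E))
          + (spectral_norm Pn ^+ 2 * sigma ^+ 2 / n%:R)%:E *
            (C'%:E * \esum_(m in [set: M])
               (expR (- (C'' * L m * trace_term Pn (S m)
                         / spectral_norm Pn ^+ 2)))%:E))%E.
Proof.
have /andP[al0 al1] := alpha_bound theta_gt0.
have /andP[ka0 ka1] := kappa_bound theta_gt0.
have [alka1 _] := alpha_kappa_bound theta_gt0.
set al := theta / (2 * (1 + theta)) in al0 al1 alka1 *.
set ka := theta / (8 * (1 + theta)) in ka0 ka1 alka1 *.
(* The factor 3/2 comes from AM-GM, 1 / al from the kept fraction of the loss, and the last factor
   from recovering the subtracted trace. *)
pose C := 3 / 2 / al * ((1 + theta) / theta).
(* The 2 comes from summing over models, 1 and [expR 1] from the two deviations, and the denominator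
   from the scales of loss and exponents. *)
pose C' := 2 * (1 + expR 1) / (al * ka).
have e0 : 0 < 1 + expR 1 :> R by rewrite addr_gt0 ?expR_gt0.
have th1 : 1 < (1 + theta) / theta by rewrite ltr_pdivlMr// mul1r ltrDr.
have C'0 : 0 < C' by apply: divr_gt0; exact: mulr_gt0.
have C1 : 1 < C.
  have : 1 < 3 / 2 / al by rewrite ltr_pdivlMr//; lra.
  rewrite /C; nra.
(* The half reflects the equal split of the weight between the two noise terms. *)
exists C, C', (ka / 2); split.
  by split=> //; exact: divr_gt0.
move=> n Pn s sigma d T P eps M S L pen mhat Y stilde Pn0 _ sigma0 gauss _ L0
  pen0 pen_ge sel.
have n0 : (0 < n)%N.
  rewrite lt0n; apply: contraNneq Pn0 => n0.
  by apply/eqP/matrixP => i; have := ltn_ord i; rewrite {2}n0.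
have ie := standard_gaussian_iid_normal gauss.
have n0R : 0 < n%:R :> R by rewrite ltr0n.
set rho := spectral_norm Pn.
have rho0 : 0 < rho by exact: spectral_norm_gt0.
set r := rho ^+ 2; have r0 : 0 < r by rewrite exprn_gt0.
set s2 := sigma ^+ 2; have s20 : 0 < s2 by rewrite exprn_gt0.
have Pr x : dot (Pn *m x) (Pn *m x) <= r * dot x x.
  exact: dot_mulmx_le_spectral_norm.
pose Q m := orthproj (S m); pose t m := trace_term Pn (S m).
have Qs m : (Q m)^T = Q m by exact: orthproj_sym.
have Qi m : Q m *m Q m = Q m by exact: orthproj_idem.
pose A m := Q m *m Pn; pose b m := (unitv (s - Q m *m s))^T *m Pn.
have tE m : t m = \tr (A m *m (A m)^T) by exact: trace_termE.
have t0 m : 0 <= t m by rewrite tE trace_mulmx_tr_ge0.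
have Ar m x : dot (A m *m x) (A m *m x) <= r * dot x x.
  by rewrite -mulmxA; apply: le_trans (Pr x); exact: dot_proj_le.
have bE m x : dot (b m *m x) (b m *m x) = dot (unitv (s - Q m *m s)) (Pn *m x) ^+ 2.
  by rewrite dotE big_ord1 -expr2 /dot mulmxA.
have br m x : dot (b m *m x) (b m *m x) <= r * dot x x.
  rewrite bE; apply: le_trans (dot_CauchySchwarz _ _) _.
  apply: le_trans (Pr x); rewrite ler_piMl ?dot_ge0//; exact: dot_unitv_le1.
(* This trace is |P^T u|^2 for a vector u of norm at most 1, and transposition preserves the bound
   on P. *)
have tb m : \tr (b m *m (b m)^T) <= r.
  rewrite trace_mx11 -{1}(trmxK (b m)) -/(dot _ _) trmx_mul trmxK.
  apply: le_trans (opnorm_tr_le (ltW r0) Pr _) _.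
  by rewrite ler_piMr ?dot_unitv_le1// ltW.
pose x w : 'cV[R]_n := \col_i eps i w.
pose e m := ka / 2 * L m * t m / r.
pose G1 m := deviation eps (A m) r (ka * (1 + al)) (ka * (1 + theta) * t m / r + e m).
pose G2 m := deviation eps (b m) r (2 * ka) (e m).
pose B := s2 * r / ka; have B0 : 0 < B by apply: divr_gt0 => //; exact: mulr_gt0.
pose k := (al * n%:R)^-1; have k0 : 0 < k by rewrite invr_gt0 mulr_gt0.
pose crit m := nnorm (s - Q m *m s) ^+ 2 + pen m - t m / n%:R * s2.
have penn m : (1 + theta + L m) * t m * s2 <= n%:R * pen m.
  have := pen_ge m; rewrite -/s2 -/(t m) -(ler_pM2l n0R); apply: le_trans.
  by rewrite le_eqVlt; apply/orP; left; apply/eqP; field; rewrite gt_eqF.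
(* If y is the trace term, pen >= (1 + theta) y gives pen <= (1 + theta) / theta (pen - y). *)
have crit_ge m : 3 / 2 * k * (dot (s - Q m *m s) (s - Q m *m s) + n%:R * pen m)
    <= C * crit m.
  set D := dot _ _; have D0 : 0 <= D by exact: dot_ge0.
  have y0 : 0 <= t m / n%:R * s2 by rewrite mulr_ge0 ?divr_ge0 ?t0// ltW.
  have peny : (1 + theta) * (t m / n%:R * s2) <= pen m.
    by apply: le_trans (pen_ge m); rewrite -/s2 -/(t m) -[leRHS]mulrA ler_wpM2r// lerDl.
  have -> : 3 / 2 * k * (D + n%:R * pen m) = 3 / 2 / al * (n%:R^-1 * D + pen m).
    by rewrite /k; field; rewrite !gt_eqF.
  rewrite /C -[leRHS]mulrA ler_wpM2l//; first by apply: divr_ge0 => //; exact: ltW.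
  rewrite /crit nnorm_sqr -/D.
  have D'0 : 0 <= n%:R^-1 * D by rewrite mulr_ge0 ?invr_ge0.
  rewrite mulrAC ler_pdivlMr//.
  by move: peny; move: (t m / n%:R * s2) (n%:R^-1 * D) D'0 => y D' D'0 peny; nra.
have pw w m : nnorm (s - stilde w) ^+ 2 <=
    C * crit m + k * B * (G1 m w + G2 m w) + k * B * (G1 (mhat w) w + G2 (mhat w) w).
  pose err := dot (s - stilde w) (s - stilde w).
  have main : al * err <= 3 / 2 * dot (s - Q m *m s) (s - Q m *m s) +
      n%:R * pen m + 2 * (s2 * dot (b m *m x w) (b m *m x w)) +
      ((1 + al) * (s2 * dot (A (mhat w) *m x w) (A (mhat w) *m x w)) +
       2 * (s2 * dot (b (mhat w) *m x w) (b (mhat w) *m x w)) -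
       n%:R * pen (mhat w)).
    apply: (selection_error_noise_le (Qs m) (Qi m) (Qs (mhat w)) (Qi (mhat w))).
      by rewrite (ltW al0) al1.
    exact: penalized_minimizer_dot (sel w).
  have -> : nnorm (s - stilde w) ^+ 2 = k * (al * err).
    rewrite nnorm_sqr -/err; move: err {main} => err.
    by rewrite /k; field; rewrite !gt_eqF.
  apply: (@penalized_bound_combine _ _ _ _ _ _ _ (L m * t m * s2) _ _ _ _ _
    (ltW k0) (ltW B0) _ _ main _ _ (crit_ge m)).
  - exact: expR_ge0.
  - apply: le_trans (penn m); rewrite ler_wpM2r ?(ltW s20)// ler_wpM2r//.
    by rewrite lerDr addr_ge0// ltW.
  - exact: (excess_le_deviation theta_gt0 _ _ s20 r0 (penn (mhat w))).
  - exact: (square_le_deviation theta_gt0 _ _ _ s20 r0).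
(* The quadratic form contributes [expR (- e m)], the one-row form [expR 1] times as much. *)
have EG m : (\int[P]_w (k * B * (G1 m w + G2 m w))%:E <=
    (k * B * (1 + expR 1) * expR (- e m))%:E)%E.
  have mG1 : measurable_fun setT (G1 m) by exact: measurable_deviation.
  have mG2 : measurable_fun setT (G2 m) by exact: measurable_deviation.
  under eq_integral do rewrite EFinM EFinD.
  rewrite ge0_integralZl//; last 3 first.
  - by apply/measurable_EFinP; exact: measurable_funD.
  - by move=> w _; rewrite lee_fin addr_ge0// expR_ge0.
  - by rewrite lee_fin ltW// mulr_gt0.
  rewrite -[k * B * _ * _]mulrA [leRHS]EFinM; apply: lee_wpmul2l.
    by rewrite lee_fin ltW// mulr_gt0.
  rewrite ge0_integralD//; last 4 first.
  - by move=> w _; rewrite lee_fin expR_ge0.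
  - exact/measurable_EFinP.
  - by move=> w _; rewrite lee_fin expR_ge0.
  - exact/measurable_EFinP.
  rewrite mulrDl mul1r EFinD; apply: leeD.
    have kal : 0 < ka * (1 + al) by rewrite mulr_gt0// addr_gt0.
    apply: le_trans (integral_deviation_le _ ie r0 kal alka1 (Ar m)) _.
    by rewrite -tE lee_fin; exact: deviation_exponent_le.
  apply: le_trans (integral_deviation_le _ ie r0 _ _ (br m)) _.
  - by rewrite mulr_gt0.
  - lra.
  - by rewrite lee_fin; exact: deviation_exponent_unit_le.
rewrite muleA -EFinM.
have crit0 m : 0 <= C * crit m.
  apply: le_trans (crit_ge m); apply: mulr_ge0.
    by apply: mulr_ge0 => //; exact: ltW.
  by apply: addr_ge0; [exact: dot_ge0|exact: mulr_ge0].
have kB0 : 0 < k * B by exact: mulr_gt0.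
have kBE : 2 * (k * B * (1 + expR 1)) = r * s2 / n%:R * C'.
  by rewrite /k /B /C'; field; rewrite !gt_eqF.
apply: le_affine_ereal_inf.
- by apply: lt_trans C1.
- by move=> m; rewrite -(pmulr_rge0 _ (lt_trans ltr01 C1)); exact: crit0.
- apply: mule_ge0; last by apply: esum_ge0 => m _; rewrite lee_fin expR_ge0.
  rewrite lee_fin; apply/ltW/mulr_gt0 => //; apply: divr_gt0 => //.
  exact: mulr_gt0.
move=> m; rewrite -[X in (X%:E * _)%E]kBE.
apply: (@expectation_selection_le _ _ _ P M _ _
  (fun m w => k * B * (G1 m w + G2 m w)) (fun m => expR (- e m)) _ m mhat).
- exact: crit0.
- by apply/ltW/mulr_gt0.
- by move=> m'; exact: expR_ge0.
- by move=> w; exact: sqr_ge0.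
- move=> m' w; apply: mulr_ge0; first exact: ltW.
  by apply: addr_ge0; exact: expR_ge0.
- move=> m'; apply: measurable_funM => //.
  by apply: measurable_funD; exact: measurable_deviation.
- exact: EG.
- by move=> w; exact: pw.
Qed.
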